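(* Let $(Q,\cdot)$ be a quasigroup (respectively, a loop) and let $(F,A)$ be a soft set over $Q$. Then $(F,A)_{(Q,\cdot)}$ is a soft quasigroup (respectively, a soft loop) if and only if all of the following are true: (1) $(F,A)_{(Q,\cdot)}$ is a soft groupoid; (2) $(F,A)_{(Q,\backslash)}$ is a soft groupoid; (3) $(F,A)_{(Q,/)}$ is a soft groupoid.
   Context: A groupoid is a nonempty set with a binary operation. A quasigroup is a groupoid $(Q,\cdot)$ in which for all $a,b\in Q$ each of the equations $a\cdot x=b$ and $y\cdot a=b$ has a unique solution in $Q$. A loop is a quasigroup with a two-sided identity element. In a quasigroup $(Q,\cdot)$ the operations $/$ and $\backslash$ on $Q$ are defined by $x\backslash y=z\Leftrightarrow x\cdot z=y$ and $x/y=z\Leftrightarrow z\cdot y=x$. A nonempty subset $H\subseteq Q$ is a subgroupoid (subquasigroup, subloop) of $(Q,\ast)$ if $H$ is closed under $\ast$ and $(H,\ast)$ is a groupoid (quasigroup, loop) under the restricted operation. A soft set $(F,A)$ over a set $Q$ consists of a set $A$ of parameters and a map $F:A\to 2^{Q}\setminus\{\emptyset\}$. For a binary operation $\ast$ on $Q$, $(F,A)_{(Q,\ast)}$ denotes this soft set regarded over $(Q,\ast)$; it is called a soft groupoid (soft quasigroup, soft loop) if $F(a)$ is a subgroupoid (subquasigroup, subloop) of $(Q,\ast)$ for all $a\in A$. *)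

(* Defs.v *)
From mathcomp Require Import all_boot boolp classical_sets.

Set Implicit Arguments.
Unset Strict Implicit.
Unset Printing Implicit Defensive.

Local Open Scope classical_set_scope.

(* The structures are predicates on a binary operation rather than bundled
   types, since one carrier is considered with several operations. *)

Definition groupoid (Q : Type) (op : Q -> Q -> Q) : Prop := inhabited Q.

Definition quasigroup (Q : Type) (op : Q -> Q -> Q) : Prop :=
  groupoid op /\
  forall a b : Q, (exists! x, op a x = b) /\ (exists! y, op y a = b).

Definition loop (Q : Type) (op : Q -> Q -> Q) : Prop :=
  quasigroup op /\ exists e : Q, forall x : Q, op e x = x /\ op x e = x.

Lemma loop_quasigroup (Q : Type) (op : Q -> Q -> Q) :
  loop op -> quasigroup op.
Proof. by case. Qed.

(* [ldiv qQ x y] is x \ y and [rdiv qQ x y] is x / y; see [ldivP], [rdivP]. *)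
Definition ldiv (Q : Type) (op : Q -> Q -> Q) (qQ : quasigroup op) (x y : Q) :
    Q :=
  projT1 (cid (proj1 (proj2 qQ x y))).

Definition rdiv (Q : Type) (op : Q -> Q -> Q) (qQ : quasigroup op) (x y : Q) :
    Q :=
  projT1 (cid (proj2 (proj2 qQ y x))).

Lemma ldivP (Q : Type) (op : Q -> Q -> Q) (qQ : quasigroup op) (x y z : Q) :
  ldiv qQ x y = z <-> op x z = y.
Proof.
rewrite /ldiv; case: cid => w /= [opw w_uniq].
by split=> [<- | /w_uniq].
Qed.

Lemma rdivP (Q : Type) (op : Q -> Q -> Q) (qQ : quasigroup op) (x y z : Q) :
  rdiv qQ x y = z <-> op z y = x.
Proof.
rewrite /rdiv; case: cid => w /= [opw w_uniq].
by split=> [<- | /w_uniq].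
Qed.

Definition closed_under (Q : Type) (op : Q -> Q -> Q) (H : set Q) : Prop :=
  forall x y : Q, H x -> H y -> H (op x y).

(* The set [H] is coerced to the subtype of its elements. *)
Definition restricted_op (Q : Type) (op : Q -> Q -> Q) (H : set Q)
    (cH : closed_under op H) (x y : H) : H :=
  SigSub (mem_set (cH (val x) (val y) (set_valP x) (set_valP y))).

Definition subgroupoid (Q : Type) (op : Q -> Q -> Q) (H : set Q) : Prop :=
  H !=set0 /\ exists cH : closed_under op H, groupoid (restricted_op cH).

Definition subquasigroup (Q : Type) (op : Q -> Q -> Q) (H : set Q) : Prop :=
  H !=set0 /\ exists cH : closed_under op H, quasigroup (restricted_op cH).

(* The identity of a subloop is not assumed to be that of the ambient
   operation. *)
Definition subloop (Q : Type) (op : Q -> Q -> Q) (H : set Q) : Prop :=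
  H !=set0 /\ exists cH : closed_under op H, loop (restricted_op cH).

Record soft_set (A Q : Type) := SoftSet {
  soft_map :> A -> set Q;
  soft_map_nonempty : forall a : A, soft_map a !=set0
}.

Definition soft_groupoid (A Q : Type) (op : Q -> Q -> Q) (F : soft_set A Q) :
    Prop :=
  forall a : A, subgroupoid op (F a).

Definition soft_quasigroup (A Q : Type) (op : Q -> Q -> Q) (F : soft_set A Q) :
    Prop :=
  forall a : A, subquasigroup op (F a).

Definition soft_loop (A Q : Type) (op : Q -> Q -> Q) (F : soft_set A Q) :
    Prop :=
  forall a : A, subloop op (F a).

(* Main.v *)
Require Import Defs.
From mathcomp Require Import all_boot boolp classical_sets.

(** Everything happens for one subset [H] at a time.  The solutions of
    [a * x = b] and [y * a = b] in the ambient quasigroup are [a \ b] and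
    [b / a], and they are the only ones.  If [H] is a quasigroup, its own
    solutions must therefore be these quotients, so [H] is closed under both
    divisions; conversely, closure under the divisions puts the ambient
    solutions inside [H], where they stay unique
    ([subquasigroup_closed_divisions]).

    For a loop with identity [e], any element [x] of a subquasigroup satisfies
    [x \ x = e], so a nonempty subquasigroup contains [e] and is
    automatically a subloop ([subloop_subquasigroup]).  The loop case thus
    reduces to the quasigroup case. *)

Lemma subgroupoidE {Q : Type} {op : Q -> Q -> Q} (H : set Q) :
  subgroupoid op H = (nonempty H /\ closed_under op H).
Proof.
apply/propext; split=> [[H0 [cH _]] // | [[x Hx] cH]].
by split; [exists x | exists cH; split; exact: (SigSub (mem_set Hx))].
Qed.

(** Uniqueness of solutions in [Q] drives both directions: it identifies a
    solution found in [H] with the quotient, and it is inherited by [H]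
    because the inclusion of [H] in [Q] is injective. *)
Lemma subquasigroup_closed_divisions {Q : Type} {op : Q -> Q -> Q}
    (qQ : quasigroup op) (H : set Q) :
  subquasigroup op H <->
  [/\ subgroupoid op H, subgroupoid (ldiv qQ) H & subgroupoid (rdiv qQ) H].
Proof.
rewrite !subgroupoidE; split.
  move=> [H0 [cH [_ solH]]]; split; split=> // x y Hx Hy.
  - have [[z [opz _]] _] := solH (SigSub (mem_set Hx)) (SigSub (mem_set Hy)).
    have /ldivP -> : op x (val z) = y by exact: (congr1 val opz).
    exact: set_valP.
  - have [_ [z [opz _]]] := solH (SigSub (mem_set Hy)) (SigSub (mem_set Hx)).
    have /rdivP -> : op (val z) y = x by exact: (congr1 val opz).
    exact: set_valP.
move=> [[[h Hh] cH] [_ cl] [_ cr]].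
split; first by exists h.
exists cH; split=> [|a b]; first exact: (inhabits (SigSub (mem_set Hh))).
have [Ha Hb] := (set_valP a, set_valP b).
split.
- exists (SigSub (mem_set (cl _ _ Ha Hb))); split.
    by apply: val_inj; apply/(ldivP qQ).
  by move=> z opz; apply: val_inj; apply/ldivP; exact: (congr1 val opz).
- exists (SigSub (mem_set (cr _ _ Hb Ha))); split.
    by apply: val_inj; apply/(rdivP qQ).
  by move=> z opz; apply: val_inj; apply/rdivP; exact: (congr1 val opz).
Qed.

(** The equation [x * e = x] turns closure under left division into membership
    of the ambient identity [e] in [H], where it still acts as an identity. *)
Lemma subloop_subquasigroup {Q : Type} {op : Q -> Q -> Q} (lQ : loop op)
    (H : set Q) :
  subloop op H <-> subquasigroup op H.
Proof.
split=> [[H0 [cH [qH _]]] | sH]; first by split=> //; exists cH.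
have [_ + _] :=
  (subquasigroup_closed_divisions (loop_quasigroup lQ) H).1 sH.
rewrite subgroupoidE => -[[x Hx] cl].
have [H0 [cH qH]] := sH; have [_ [e idQ]] := lQ.
have He : H e.
  have /(ldivP (loop_quasigroup lQ)) <- : op x e = x by exact: (idQ x).2.
  exact: cl.
split=> //; exists cH; split=> //; exists (SigSub (mem_set He)) => y.
by split; apply: val_inj; [exact: (idQ _).1 | exact: (idQ _).2].
Qed.

Lemma soft_quasigroup_closed_divisions {Q A : Type} {op : Q -> Q -> Q}
    {F : soft_set A Q} (qQ : quasigroup op) :
  soft_quasigroup op F <->
  [/\ soft_groupoid op F, soft_groupoid (ldiv qQ) F &
      soft_groupoid (rdiv qQ) F].
Proof.
split=> [sF | [gF lF rF] a].
  by split=> a; have [] := (subquasigroup_closed_divisions qQ _).1 (sF a).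
by apply/(subquasigroup_closed_divisions qQ).
Qed.

Theorem theorem3p2 (Q A : Type) (op : Q -> Q -> Q) (F : soft_set A Q) :
  (forall qQ : quasigroup op,
     soft_quasigroup op F <->
     [/\ soft_groupoid op F,
         soft_groupoid (ldiv qQ) F &
         soft_groupoid (rdiv qQ) F]) /\
  (forall lQ : loop op,
     soft_loop op F <->
     [/\ soft_groupoid op F,
         soft_groupoid (ldiv (loop_quasigroup lQ)) F &
         soft_groupoid (rdiv (loop_quasigroup lQ)) F]).
Proof.
split=> [qQ | lQ]; first exact: soft_quasigroup_closed_divisions.
rewrite -soft_quasigroup_closed_divisions.
by split=> sF a; apply/(subloop_subquasigroup lQ); exact: sF.
Qed.
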